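(* There exists a finitely generated tree-like inverse monoid which is not finitely presentable (as an inverse monoid).
   Context: An inverse monoid is a monoid in which every element $s$ has a unique $s^{-1}$ with $ss^{-1}s=s$ and $s^{-1}ss^{-1}=s^{-1}$. Let $A^{-1}$ be a set of formal inverses of $A$, disjoint from $A$, and give $(A\cup A^{-1})^*$ the obvious involution. The inverse monoid $\mathrm{Inv}\langle A\mid R\rangle$, $R\subseteq (A\cup A^{-1})^*\times(A\cup A^{-1})^*$, is the quotient of $(A\cup A^{-1})^*$ by the congruence generated by $R$ and all pairs $(uu^{-1}u,u)$, $(uu^{-1}vv^{-1},vv^{-1}uu^{-1})$. An inverse monoid is finitely presentable if it is isomorphic to some $\mathrm{Inv}\langle A\mid R\rangle$ with $A$ and $R$ finite. The Cayley graph of an inverse monoid $M$ generated (as an inverse monoid) by $A$ has vertex set $M$ and an edge labeled $a$ from $s$ to $sa$ for all $s\in M$, $a\in A\cup A^{-1}$. The Schützenberger graphs of $M$ are the strongly connected components of this Cayley graph; their edges occur in inverse pairs and they are metric spaces under the path metric on vertices. A finitely generated inverse monoid is tree-like if each of its Schützenberger graphs (with respect to some, equivalently any, finite generating set) is quasi-isometric to a tree. *)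

(* Defs.v *)
From HB Require Import structures.
From mathcomp Require Import all_boot all_order all_algebra.
From mathcomp Require Import boolp classical_sets cardinality reals.

Set Implicit Arguments.
Unset Strict Implicit.
Unset Printing Implicit Defensive.

Import Order.TTheory GRing.Theory Num.Theory.

Local Open Scope classical_set_scope.
Local Open Scope quotient_scope.
Local Open Scope group_scope.

(* The *-monoid axioms follow from the three axioms of the mixin: see the
   factory [isInverseMonoid] below. They are inherited only so that the
   structure fits into the hierarchy of MathComp. *)
HB.mixin Record StarMonoid_isInverseMonoid M of StarMonoid M := {
  mulgVg : forall s : M, s * s^-1 * s = s;
  mulVgV : forall s : M, s^-1 * s * s^-1 = s^-1;
  invg_uniq : forall s t : M, s * t * s = s -> t * s * t = t -> t = s^-1
}.

#[short(type="inverseMonoidType")]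
HB.structure Definition InverseMonoid :=
  {M of StarMonoid_isInverseMonoid M & StarMonoid M}.

Bind Scope group_scope with InverseMonoid.sort.

HB.factory Record isInverseMonoid M of Monoid M := {
  inv : M -> M;
  mulgVg : forall s : M, s * inv s * s = s;
  mulVgV : forall s : M, inv s * s * inv s = inv s;
  invg_uniq : forall s t : M, s * t * s = s -> t * s * t = t -> t = inv s
}.

HB.builders Context M of isInverseMonoid M.

HB.instance Definition _ := hasInv.Build M inv.

Fact invgK_subproof : involutive inv.
Proof. by move=> s; apply/esym/invg_uniq; rewrite ?mulgVg ?mulVgV. Qed.

Fact idem_inv (e : M) : e * e = e -> inv e = e.
Proof. by move=> ee; apply/esym/invg_uniq; rewrite !ee. Qed.

Fact idemM (e f : M) : e * e = e -> f * f = f -> (e * f) * (e * f) = e * f.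
Proof.
move=> ee ff; have := mulgVg (e * f); have := mulVgV (e * f).
have: inv (inv (e * f)) = e * f := invgK_subproof (e * f).
have: forall t, _ -> _ -> t = inv (e * f) := invg_uniq (s := e * f).
move: (inv (e * f)) => x xU xV xefx efxef.
have xE : f * x * e = x.
  apply: xU.
    rewrite !mulgA -(mulgA e f f) ff -[_ * e * e]mulgA ee.
    by rewrite -[RHS]efxef !mulgA.
  rewrite !mulgA -[_ * e * e]mulgA ee -[_ * f * f]mulgA ff.
  by rewrite -[in RHS]xefx !mulgA.
have xx : x * x = x.
  by rewrite -{1 2}xE -[RHS]xE -[in RHS]xefx !mulgA.
by rewrite -xV (idem_inv xx).
Qed.

Fact idemC (e f : M) : e * e = e -> f * f = f -> e * f = f * e.
Proof.
move=> ee ff; have efef := idemM ee ff; have fefe := idemM ff ee.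
rewrite -[LHS]idem_inv //; apply/esym/invg_uniq.
  by rewrite !mulgA -(mulgA e f f) ff -(mulgA _ e e) ee -mulgA efef.
by rewrite !mulgA -(mulgA f e e) ee -(mulgA _ f f) ff -mulgA fefe.
Qed.

Fact invgM_subproof : {morph inv : x y / x * y >-> y * x}.
Proof.
move=> x y /=; apply/esym/invg_uniq.
  have C : (y * inv y) * (inv x * x) = (inv x * x) * (y * inv y).
    by apply: idemC; rewrite mulgA ?mulgVg ?mulVgV.
  transitivity (x * ((y * inv y) * (inv x * x)) * y); first by rewrite !mulgA.
  by rewrite C !mulgA mulgVg -!mulgA (mulgA y) mulgVg.
have C : (inv x * x) * (y * inv y) = (y * inv y) * (inv x * x).
  by apply: idemC; rewrite mulgA ?mulgVg ?mulVgV.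
transitivity (inv y * ((inv x * x) * (y * inv y)) * inv x).
  by rewrite !mulgA.
by rewrite C !mulgA mulVgV -!mulgA (mulgA (inv x)) mulVgV.
Qed.

HB.instance Definition _ :=
  Monoid_isStarMonoid.Build M invgK_subproof invgM_subproof.
HB.instance Definition _ :=
  StarMonoid_isInverseMonoid.Build M mulgVg mulVgV invg_uniq.

HB.end.

Definition isomorphic (M N : inverseMonoidType) : Prop :=
  exists2 f : M -> N, monoid.monoid_morphism f & bijective f.

Section Presentation.

Variable A : choiceType.

(* [inl a] is the letter a, [inr a] its formal inverse. *)
Definition word := seq (A + A).

Definition letter_inv (x : A + A) : A + A :=
  match x with inl a => inr a | inr a => inl a end.

Definition word_inv (u : word) : word := rev (map letter_inv u).

Lemma word_invK : involutive word_inv.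
Proof.
move=> u; rewrite /word_inv map_rev revK -map_comp.
by rewrite -[RHS]map_id; apply: eq_map => -[].
Qed.

Variable R : set (word * word).

Inductive inv_cong : word -> word -> Prop :=
| inv_cong_rel u v : R (u, v) -> inv_cong u v
| inv_cong_regular u : inv_cong (u ++ word_inv u ++ u) u
| inv_cong_commute u v :
    inv_cong (u ++ word_inv u ++ v ++ word_inv v)
             (v ++ word_inv v ++ u ++ word_inv u)
| inv_cong_refl u : inv_cong u u
| inv_cong_sym u v : inv_cong u v -> inv_cong v u
| inv_cong_trans u v w : inv_cong u v -> inv_cong v w -> inv_cong u w
| inv_cong_cat u u' v v' :
    inv_cong u u' -> inv_cong v v' -> inv_cong (u ++ v) (u' ++ v').

Definition inv_congb : rel word := fun u v => `[< inv_cong u v >].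

Lemma inv_congb_refl : reflexive inv_congb.
Proof. by move=> u; apply/asboolP; exact: inv_cong_refl. Qed.

Lemma inv_congb_sym : symmetric inv_congb.
Proof. by move=> u v; apply/asboolP/asboolP; exact: inv_cong_sym. Qed.

Lemma inv_congb_trans : transitive inv_congb.
Proof.
move=> v u w /asboolP uv /asboolP vw; apply/asboolP.
exact: inv_cong_trans uv vw.
Qed.

Canonical inv_congb_equiv :=
  EquivRel inv_congb inv_congb_refl inv_congb_sym inv_congb_trans.

Definition Inv := {eq_quot inv_congb}.

HB.instance Definition _ := Choice.on Inv.

Definition inv_class (u : word) : Inv := \pi_({eq_quot inv_congb}) u.
Definition inv_repr (x : Inv) : word := repr x.

Lemma inv_classP u v : inv_class u = inv_class v <-> inv_cong u v.
Proof.
by split=> [/eqquotP/asboolP //|uv]; apply/eqquotP/asboolP.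
Qed.

Lemma inv_reprK : cancel inv_repr inv_class.
Proof. exact: reprK. Qed.

Definition Inv_one : Inv := inv_class [::].
Definition Inv_mul (x y : Inv) : Inv := inv_class (inv_repr x ++ inv_repr y).
Definition Inv_inv (x : Inv) : Inv := inv_class (word_inv (inv_repr x)).

Lemma inv_class_cat u v :
  inv_class (u ++ v) = Inv_mul (inv_class u) (inv_class v).
Proof.
by apply/inv_classP/inv_cong_cat; apply/inv_classP; rewrite inv_reprK.
Qed.

Fact Inv_mulA : associative Inv_mul.
Proof.
move=> x y z; rewrite -(inv_reprK x) -(inv_reprK y) -(inv_reprK z).
by rewrite -!inv_class_cat catA.
Qed.

Fact Inv_1mul : left_id Inv_one Inv_mul.
Proof. by move=> x; rewrite -(inv_reprK x) -inv_class_cat. Qed.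

Fact Inv_mul1 : right_id Inv_one Inv_mul.
Proof. by move=> x; rewrite -(inv_reprK x) -inv_class_cat cats0. Qed.

HB.instance Definition _ := isMonoid.Build Inv Inv_mulA Inv_1mul Inv_mul1.

Lemma inv_class1 : inv_class [::] = 1.
Proof. by []. Qed.

Lemma inv_classM u v : inv_class (u ++ v) = inv_class u * inv_class v.
Proof. exact: inv_class_cat. Qed.

Fact Inv_mulgVg (x : Inv) : x * Inv_inv x * x = x.
Proof.
move: (inv_reprK x); rewrite /Inv_inv; move: (inv_repr x) => u <-.
by rewrite -!inv_classM -catA; apply/inv_classP/inv_cong_regular.
Qed.

Fact Inv_mulVgV (x : Inv) : Inv_inv x * x * Inv_inv x = Inv_inv x.
Proof.
move: (inv_reprK x); rewrite /Inv_inv; move: (inv_repr x) => u <-.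
rewrite -!inv_classM -catA; apply/inv_classP.
by have := inv_cong_regular (word_inv u); rewrite word_invK.
Qed.

Fact Inv_mulVC (x : Inv) :
  (x * Inv_inv x) * (Inv_inv x * x) = (Inv_inv x * x) * (x * Inv_inv x).
Proof.
move: (inv_reprK x); rewrite /Inv_inv; move: (inv_repr x) => u <-.
rewrite -!inv_classM -!catA; apply/inv_classP.
by have := inv_cong_commute u (word_inv u); rewrite word_invK.
Qed.

Fact Inv_idem (x : Inv) : x * x = x -> Inv_inv x = x.
Proof.
move=> xx; set y := Inv_inv x.
have xyx : x * y * x = x := Inv_mulgVg x.
have yxy : y * x * y = y := Inv_mulVgV x.
have C : (x * y) * (y * x) = (y * x) * (x * y) := Inv_mulVC x.
have E : (y * x) * (x * y) = y by rewrite mulgA -(mulgA y) xx yxy.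
have xyy : x * y = y by rewrite -[y in LHS]E -C !mulgA xx -[RHS]E -C !mulgA.
have yxy' : y * x = y.
  by rewrite -[in LHS]E -C -!mulgA xx -[RHS]E -C -!mulgA.
by rewrite -[RHS]xyx xyy yxy'.
Qed.

Fact Inv_idemC (x y : Inv) : x * x = x -> y * y = y -> x * y = y * x.
Proof.
move=> xx yy.
have xE : x = x * Inv_inv x by rewrite Inv_idem.
have yE : y = y * Inv_inv y by rewrite Inv_idem.
rewrite [in LHS]xE [in LHS]yE [in RHS]xE [in RHS]yE.
move: (inv_reprK x) (inv_reprK y); rewrite /Inv_inv.
move: (inv_repr x) (inv_repr y) => u v <- <-; rewrite -!inv_classM -!catA.
exact/inv_classP/inv_cong_commute.
Qed.

Fact Inv_inv_uniq (s t : Inv) :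
  s * t * s = s -> t * s * t = t -> t = Inv_inv s.
Proof.
move=> sts tst; set t' := Inv_inv s.
have st's : s * t' * s = s := Inv_mulgVg s.
have t'st' : t' * s * t' = t' := Inv_mulVgV s.
have C1 : (s * t) * (s * t') = (s * t') * (s * t).
  by apply: Inv_idemC; rewrite mulgA ?sts ?st's.
have C2 : (t * s) * (t' * s) = (t' * s) * (t * s).
  by apply: Inv_idemC; rewrite mulgA ?tst ?t'st'.
have st : s * t = s * t'.
  by transitivity ((s * t') * (s * t)); [rewrite mulgA st's | rewrite -C1 mulgA sts].
have ts : t * s = t' * s.
  by transitivity ((t * s) * (t' * s)); [rewrite -mulgA (mulgA s) st's
    | rewrite C2 -mulgA (mulgA s) sts].
by rewrite -tst ts -mulgA st mulgA t'st'.
Qed.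

HB.instance Definition _ :=
  isInverseMonoid.Build Inv Inv_mulgVg Inv_mulVgV Inv_inv_uniq.

End Presentation.

Definition finitely_presentable (M : inverseMonoidType) : Prop :=
  exists (A : finType) (R : set (word A * word A)),
    finite_set R /\ isomorphic M (Inv R).

(* Graphs are given by an edge relation on a type of vertices: multiple edges
   and labels affect neither connectivity nor the path metric. *)
Section Graph.

Variables (T : eqType) (e : rel T).

Definition has_walk (x y : T) (n : nat) : Prop :=
  exists p : seq T, [/\ path e x p, last x p = y & size p = n].

Definition reachable (x y : T) : Prop := exists n, has_walk x y n.

Definition strong_component (x : T) : set T :=
  [set y | reachable x y /\ reachable y x].

Let ex_lengthb x y : reachable x y -> exists n, `[< has_walk x y n >].
Proof. by case=> n xyn; exists n; apply/asboolP. Qed.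

(* Length of a shortest path, with the dummy value 0 if there is no path. *)
Definition path_dist (x y : T) : nat :=
  match pselect (reachable x y) with
  | left xy => ex_minn (ex_lengthb xy)
  | right _ => 0
  end.

Lemma path_dist_walk x y : reachable x y -> has_walk x y (path_dist x y).
Proof.
rewrite /path_dist => xy; case: pselect => // xy'.
by case: ex_minnP => n /asboolP.
Qed.

Lemma path_dist_min x y n : has_walk x y n -> path_dist x y <= n.
Proof.
rewrite /path_dist => xyn; case: pselect => // xy.
by case: ex_minnP => m _; apply; apply/asboolP.
Qed.

Definition is_tree : Prop :=
  [/\ symmetric e, irreflexive e, (forall x y, reachable x y)
    & forall c : seq T, ucycle e c -> size c <= 2].

End Graph.

Section Cayley.

Variables (M : inverseMonoidType) (A : set M).

Definition inverse_submonoid (S : set M) : Prop :=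
  [/\ S 1, (forall s t, S s -> S t -> S (s * t)) & forall s, S s -> S s^-1].

Definition generates : Prop := smallest inverse_submonoid A = setT.

Definition cayley : rel M := fun s t =>
  `[< exists2 a, A a & t = s * a \/ t = s * a^-1 >].

Definition schutzenberger (s : M) : rel (strong_component cayley s) :=
  relpre val cayley.

End Cayley.

Arguments schutzenberger {M} A s.

Local Open Scope ring_scope.

Definition quasi_isometry (R : realType) (X Y : Type)
    (dX : X -> X -> nat) (dY : Y -> Y -> nat) (f : X -> Y) : Prop :=
  exists L C : R, [/\ 1 <= L, 0 <= C,
    (forall x x', L^-1 * (dX x x')%:R - C <= (dY (f x) (f x'))%:R
                  /\ (dY (f x) (f x'))%:R <= L * (dX x x')%:R + C)
    & forall y, exists x, (dY y (f x))%:R <= C].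

Definition quasi_isometric_to_tree (R : realType) (X : eqType) (e : rel X) :
    Prop :=
  exists (T : eqType) (t : rel T), is_tree t /\
    exists f : X -> T, quasi_isometry R (path_dist e) (path_dist t) f.

Definition tree_like (R : realType) (M : inverseMonoidType) : Prop :=
  exists A : set M, [/\ finite_set A, generates A
    & forall s : M, quasi_isometric_to_tree R (schutzenberger A s)].

(* Main.v *)
From mathcomp Require Import all_boot all_order all_algebra.
From mathcomp Require Import boolp classical_sets cardinality.
From mathcomp Require Import reals zify.
Require Import Defs.

(** The monoid is generated by two letters a and b. Both move one step to the
    right along a line whose edges may carry a, b, both or neither, and a
    letter is undefined where its edge is missing. A word is thus given by its
    total shift and by the set of pairs (line, position) from which it can be
    read. Identifying words with the same shift and the same domain on a fixed
    class S of lines gives an inverse monoid, the one presented by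
    [read_kernel S]. Take for S the lines in which every a-edge lying to the
    right of another a-edge is doubled by a b-edge.

    Tree-likeness: elements in one Schützenberger graph have the same domain,
    hence are told apart by their shifts. The domain of a word contains a point
    of a finite line in S, namely a long enough interval carrying both
    letters; reading a word cannot leave a finite line, so only finitely many
    shifts occur. Schützenberger graphs are finite, hence quasi-isometric to a
    one-vertex tree.

    No finite presentation: let S_n be the larger class of lines where only
    a-edges at distance at most n from an earlier one have to be doubled. A
    word sees a bounded part of the line, and truncating a line of S_n to an
    interval of length at most n puts it in S, so each relation of the monoid
    holds over S_n for all large n ([always_doubled_limit]). By the usual
    compactness argument ([finitely_presentable_limit]), a finite presentation
    would make all of them hold over one S_n; but saying that the second of two
    a-edges at distance n + 1 is doubled is a relation which fails over S_n
    ([doubled_kernel_strict]). *)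

Set Implicit Arguments.
Unset Strict Implicit.
Unset Printing Implicit Defensive.

Import Order.TTheory GRing.Theory Num.Theory.

Local Open Scope classical_set_scope.
Local Open Scope group_scope.

(** * Finite presentability is a compactness property *)

Definition eventually (P : nat -> Prop) : Prop :=
  exists N, forall n, N <= n -> P n.

Lemma eventually_and P Q :
  eventually P -> eventually Q -> eventually (fun n => P n /\ Q n).
Proof.
move=> [N PN] [N' QN]; exists (maxn N N') => n; rewrite geq_max => /andP[? ?].
by split; [exact: PN | exact: QN].
Qed.

Lemma eventually_seq (T : eqType) (s : seq T) (P : T -> nat -> Prop) :
  (forall x, x \in s -> eventually (P x)) ->
  eventually (fun n => forall x, x \in s -> P x n).
Proof.
elim: s => [|y s IHs] Ps; first by exists 0.
have [] := eventually_and (Ps y (mem_head y s)) (IHs _).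
  by move=> x xs; apply: Ps; rewrite inE xs orbT.
move=> N H; exists N => n /H [Py Pn] x; rewrite inE => /orP[/eqP-> //|].
exact: Pn.
Qed.

Section Words.

Variable A : choiceType.
Implicit Types (u v : word A) (R : set (word A * word A)).

Lemma word_inv_cat u v : word_inv (u ++ v) = word_inv v ++ word_inv u.
Proof. by rewrite /word_inv map_cat rev_cat. Qed.

Lemma inv_class_inv R u : inv_class R (word_inv u) = (inv_class R u)^-1.
Proof.
apply: invg_uniq.
  rewrite -(inv_classM R u) -inv_classM -catA; apply/inv_classP.
  exact: inv_cong_regular.
rewrite -(inv_classM R (word_inv u)) -inv_classM -catA; apply/inv_classP.
by have := inv_cong_regular R (word_inv u); rewrite word_invK.
Qed.

(** A derivation uses finitely many relations. *)
Lemma eventually_inv_cong R (Rn : nat -> set (word A * word A)) :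
  (forall u v, R (u, v) -> eventually (fun n => inv_cong (Rn n) u v)) ->
  forall u v, inv_cong R u v -> eventually (fun n => inv_cong (Rn n) u v).
Proof.
move=> RRn u v; elim=> {u v}.
- exact: RRn.
- by move=> u; exists 0 => n _; exact: inv_cong_regular.
- by move=> u v; exists 0 => n _; exact: inv_cong_commute.
- by move=> u; exists 0 => n _; exact: inv_cong_refl.
- by move=> u v _ [N H]; exists N => n /H; exact: inv_cong_sym.
- move=> u v w _ H _ /(eventually_and H) [N {}H]; exists N => n /H [].
  exact: inv_cong_trans.
- move=> u u' v v' _ H _ /(eventually_and H) [N {}H]; exists N => n /H [].
  exact: inv_cong_cat.
Qed.

End Words.

Section Substitution.

Variables (A B : choiceType).
Implicit Types (f : A + A -> word B) (u v : word A).

Definition subst f u : word B := flatten (map f u).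

Lemma subst1 f x : subst f [:: x] = f x.
Proof. exact: cats0. Qed.

Lemma subst_cat f u v : subst f (u ++ v) = subst f u ++ subst f v.
Proof. by rewrite /subst map_cat flatten_cat. Qed.

Lemma subst_inv f u : (forall x, f (letter_inv x) = word_inv (f x)) ->
  subst f (word_inv u) = word_inv (subst f u).
Proof.
move=> fV; elim: u => // x u IHu; rewrite -cat1s word_inv_cat !subst_cat IHu.
by rewrite -[word_inv [:: x]]/[:: letter_inv x] !subst1 fV -word_inv_cat.
Qed.

(** This is the homomorphism that the universal property of a presentation
    gives, kept at the level of words. *)
Lemma inv_cong_subst (R : set (word A * word A)) (R' : set (word B * word B)) f :
    (forall x, f (letter_inv x) = word_inv (f x)) ->
    (forall u v, R (u, v) -> inv_cong R' (subst f u) (subst f v)) ->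
  forall u v, inv_cong R u v -> inv_cong R' (subst f u) (subst f v).
Proof.
move=> fV fR u v; elim=> {u v}; rewrite /= ?subst_cat.
- exact: fR.
- move=> u; rewrite !subst_cat subst_inv //; exact: inv_cong_regular.
- move=> u v; rewrite !subst_cat !subst_inv //; exact: inv_cong_commute.
- by move=> u; exact: inv_cong_refl.
- by move=> u v _; exact: inv_cong_sym.
- by move=> u v w _ uv _; exact: inv_cong_trans.
- by move=> u u' v v' _ uu' _ vv'; rewrite !subst_cat; exact: inv_cong_cat.
Qed.

Lemma inv_class_subst (R : set (word A * word A)) (R' : set (word B * word B))
    (h : Inv R -> Inv R') f :
    monoid.monoid_morphism h ->
    (forall x, inv_class R' (f x) = h (inv_class R [:: x])) ->
  forall u, inv_class R' (subst f u) = h (inv_class R u).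
Proof.
move=> [hone hmul] hf; elim=> [|x u IHu]; first by rewrite -[LHS]hone.
by rewrite -cat1s subst_cat subst1 !inv_classM hmul -hf -IHu.
Qed.

End Substitution.

Lemma morphV (M N : inverseMonoidType) (h : M -> N) (x : M) :
  monoid.monoid_morphism h -> h x^-1 = (h x)^-1.
Proof.
by case=> _ hmul; apply: invg_uniq; rewrite -!hmul; rewrite ?mulgVg ?mulVgV.
Qed.

(** Rewriting generators in terms of each other shows that finitely many
    identities decide the matter. Over the finite generating set B, write each
    letter of B as a word over A ([sigma]) and conversely ([tau]). The finitely
    many relations of B, rewritten over A, and the identities [sigma (tau x) =
    x] hold in [Inv R], hence they are all consequences of [Rn n] for some n;
    but they already imply every relation of R. *)
Lemma finitely_presentable_limit (A : finType) (R : set (word A * word A))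
    (Rn : nat -> set (word A * word A)) :
    (forall u v, R (u, v) -> eventually (fun n => inv_cong (Rn n) u v)) ->
    finitely_presentable (Inv R) ->
  exists n, forall u v, R (u, v) -> inv_cong (Rn n) u v.
Proof.
move=> RRn [B [Q [/finite_seqP [s Qs] [g gmor [h gK hK]]]]].
have hmor : monoid.monoid_morphism h.
  case: gmor => gone gmul; split; first by rewrite -gone gK.
  by move=> x y; rewrite -{1}(hK x) -{1}(hK y) -gmul gK.
pose tau x := inv_repr (g (inv_class R [:: x])).
pose sigma (y : B + B) := match y with
  | inl b => inv_repr (h (inv_class Q [:: inl b]))
  | inr b => word_inv (inv_repr (h (inv_class Q [:: inl b]))) end.
have tauP := inv_class_subst gmor (fun x => inv_reprK (g (inv_class R [:: x]))).
rewrite -/tau in tauP.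
have sigmaV y : sigma (letter_inv y) = word_inv (sigma y).
  by case: y => b //=; rewrite word_invK.
have sigmaP : forall u, inv_class R (subst sigma u) = h (inv_class Q u).
  apply: inv_class_subst => // -[] b /=; first exact: inv_reprK.
  rewrite inv_class_inv inv_reprK -morphV // -inv_class_inv //.
have evR := eventually_inv_cong RRn.
have evQ : eventually (fun n => forall p, p \in s ->
    inv_cong (Rn n) (subst sigma p.1) (subst sigma p.2)).
  apply: eventually_seq => -[u v] ps; apply/evR/inv_classP.
  by rewrite !sigmaP; congr h; apply/inv_classP/inv_cong_rel; rewrite Qs.
have evA : eventually (fun n => forall x, x \in enum {: A + A} ->
    inv_cong (Rn n) (subst sigma (tau x)) [:: x]).
  apply: eventually_seq => x _; apply/evR/inv_classP.
  by rewrite sigmaP inv_reprK gK.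
have [n /(_ n (leqnn n)) [nQ nA]] := eventually_and evQ evA.
have sub u v : inv_cong Q u v ->
    inv_cong (Rn n) (subst sigma u) (subst sigma v).
  apply: inv_cong_subst => // {}u {}v; rewrite Qs => uv.
  exact: (nQ (u, v)).
have back u : inv_cong (Rn n) (subst sigma (subst tau u)) u.
  elim: u => [|x u IHu]; first exact: inv_cong_refl.
  rewrite -cat1s [subst tau _]subst_cat subst_cat.
  apply: inv_cong_cat IHu; rewrite subst1.
  by apply: nA; rewrite mem_enum.
exists n => u v Ruv; apply: inv_cong_trans (back v).
apply: inv_cong_trans (inv_cong_sym (back u)) _; apply: sub.
by apply/inv_classP; rewrite !tauP; congr g; apply/inv_classP/inv_cong_rel.
Qed.

(** * Words acting on labelled lines *)

Local Open Scope ring_scope.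

Section Action.

Variable A : choiceType.

(** An element [x a i] is an edge labelled a from i to i + 1; different labels
    may sit on the same edge. *)
Definition line := A -> int -> Prop.

Implicit Types (u v w : word A) (x : line) (i : int) (S : set line).

Definition letter_shift (l : A + A) : int := if l is inl _ then 1 else -1.

Definition shift u : int := \sum_(l <- u) letter_shift l.

Definition crosses x i (l : A + A) : Prop :=
  match l with inl a => x a i | inr a => x a (i - 1) end.

Fixpoint reads x i u : Prop :=
  if u is l :: v then crosses x i l /\ reads x (i + letter_shift l) v else True.

Lemma shift_cons l u : shift (l :: u) = letter_shift l + shift u.
Proof. by rewrite /shift big_cons. Qed.

Lemma shift_cat u v : shift (u ++ v) = shift u + shift v.
Proof. by rewrite /shift big_cat. Qed.

Lemma shift_inv u : shift (word_inv u) = - shift u.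
Proof.
elim: u => [|l u IHu]; first by rewrite /shift big_nil.
by rewrite -cat1s word_inv_cat !shift_cat IHu /shift !big_seq1; case: l => a /=; lia.
Qed.

Lemma reads_cat x i u v :
  reads x i (u ++ v) <-> reads x i u /\ reads x (i + shift u) v.
Proof.
elim: u i => [|l u IHu] i /=; first by rewrite /shift big_nil addr0; tauto.
by rewrite IHu shift_cons addrA; tauto.
Qed.

Lemma reads_inv x i u : reads x (i + shift u) (word_inv u) <-> reads x i u.
Proof.
elim: u i => [|l u IHu] i //; rewrite -[in word_inv _]cat1s word_inv_cat.
rewrite reads_cat shift_inv shift_cons addrA IHu addrK /=.
by case: l => a /=; rewrite ?addrK ?subrK; tauto.
Qed.

Definition read_kernel S : set (word A * word A) :=
  [set p | shift p.1 = shift p.2 /\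
    forall x, S x -> forall i, reads x i p.1 <-> reads x i p.2].

(** A word acts on the pairs (line, position) as a partial injection, the
    restriction of a translation to its domain; the inverse word acts as the
    inverse partial injection. Hence the kernel of the action is already closed
    under the defining relations of inverse monoids. *)
Lemma inv_cong_read_kernel S u v :
  inv_cong (read_kernel S) u v <-> read_kernel S (u, v).
Proof.
split; last exact: inv_cong_rel.
elim=> {u v} //.
- move=> u; split=> [|x _ i] /=; first by rewrite !shift_cat shift_inv; lia.
  by rewrite !reads_cat reads_inv shift_inv addrK; tauto.
- move=> u v; split=> [|x _ i] /=; first by rewrite !shift_cat !shift_inv; lia.
  by rewrite !reads_cat !shift_inv !addrK !reads_inv; tauto.
- by move=> u v _ [/= E H]; split=> // x Sx i; rewrite H.
- move=> u v w _ [/= E H] _ [/= E' H']; split=> [|x Sx i] /=; first exact: etrans E'.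
  by rewrite H // H'.
- move=> u u' v v' _ [/= E H] _ [/= E' H'].
  split=> [|x Sx i] /=; first by rewrite !shift_cat E E'.
  by rewrite !reads_cat H // H' // E.
Qed.

(** The bound N + 1 is the right end of the last possible edge. *)
Lemma reads_window (N : int) x i u :
  (forall a j, x a j -> - N <= j <= N) -> - N <= i <= N + 1 -> reads x i u ->
  - N <= i + shift u <= N + 1.
Proof.
move=> xN; elim: u i => [|l u IHu] i iN /=; first by rewrite /shift big_nil addr0.
case=> xl; rewrite shift_cons addrA; apply: IHu.
by case: l xl => a /= /xN; lia.
Qed.

Lemma reads_local x y i u :
  (forall a j, i - (size u)%:Z <= j <= i + (size u)%:Z -> (x a j <-> y a j)) ->
  reads x i u <-> reads y i u.
Proof.
elim: u i => [|l u IHu] i //= xy.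
have IH := IHu (i + letter_shift l) _.
have -> : crosses x i l <-> crosses y i l by case: l {IH} xy => a xy /=; apply: xy; lia.
rewrite IH // => a j jN; apply: xy; move: jN; case: (l) => b /=; lia.
Qed.

End Action.

(** * Schützenberger graphs with boundedly many vertices *)

Lemma is_tree_point : is_tree (fun _ _ : unit => false).
Proof.
split=> //; first by move=> [] []; exists 0, [::].
by move=> [|x [|y c]] //= /andP[].
Qed.

(** A finite graph has bounded path metric, so it is quasi-isometric to a
    point. *)
Lemma finite_quasi_isometric_to_tree (R : realType) (X : eqType) (e : rel X) (x0 : X) :
  finite_set [set: X] -> quasi_isometric_to_tree R e.
Proof.
move=> fX; exists unit, (fun _ _ => false); split; first exact: is_tree_point.
exists (fun _ => tt).
have [D HD] : exists D : nat, forall x x', (path_dist e x x' <= D)%N.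
  have /finite_seqP[s /seteqP[sub _]] :
      finite_set [set path_dist e p.1 p.2 | p in [set: X * X]].
    by apply: finite_image; rewrite -setXTT; exact: finite_setX.
  exists (\max_(n <- s) n) => x x'; apply: leq_bigmax_seq => //.
  by apply: sub; exists (x, x').
have point_dist t t' : path_dist (fun _ _ : unit => false) t t' = 0%N.
  apply/eqP; rewrite -leqn0; apply: path_dist_min.
  by case: t t' => -[]; exists [::].
exists 1, D%:R; split; rewrite ?ler0n //.
- move=> x x'; rewrite point_dist invr1 !mul1r subr_le0 ler_nat; split=> //.
  by rewrite addr_ge0 ?ler0n.
- by case; exists x0; rewrite point_dist ler0n.
Qed.

Lemma finite_int_interval (m n : int) : finite_set [set k : int | m <= k <= n].
Proof.
apply: (@sub_finite_set _ _ [set m + k%:Z | k in `I_(absz (n - m)).+1]).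
  by move=> k /= kmn; exists (absz (k - m)); rewrite /=; lia.
exact/finite_image/finite_II.
Qed.

Section Component.

Variables (A : choiceType) (S : set (line A)).

Let M := Inv (read_kernel S).

Implicit Types (s y z : M) (x : line A).

Lemma inv_repr_class u : read_kernel S (inv_repr (inv_class (read_kernel S) u), u).
Proof. by apply/inv_cong_read_kernel/inv_classP; rewrite inv_reprK. Qed.

(** Multiplying on the right can only shrink the domain, so all elements of a
    strong component share it. *)
Lemma reachable_reads (G : set M) s y x i : S x -> reachable (cayley G) s y ->
  reads x i (inv_repr y) -> reads x i (inv_repr s).
Proof.
move=> Sx [n [p [+ <- _]]]; elim: p s => //= z p IHp s /andP[/asboolP[a _ sz] pz].
move=> /(IHp _ pz); have {sz} [c ->] : exists c : M, z = (s * c)%g.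
  by case: sz => ->; [exists a | exists a^-1%g].
rewrite -{1}(inv_reprK s) -{1}(inv_reprK c) -inv_classM.
by have [_ ->//] := inv_repr_class (inv_repr s ++ inv_repr c); case/reads_cat.
Qed.

(** Having the same domain, the elements of a component are determined by
    their shifts, and these are bounded by the size of one finite line on which
    they can all be read. *)
Lemma finite_strong_component (G : set M) s (N : int) x (i : int) :
    S x -> (forall a j, x a j -> - N <= j <= N) -> - N <= i <= N + 1 ->
    reads x i (inv_repr s) ->
  finite_set [set: strong_component (cayley G) s].
Proof.
move=> Sx xN iN xs.
have same (y : strong_component (cayley G) s) x' j : S x' ->
    reads x' j (inv_repr (val y)) <-> reads x' j (inv_repr s).
  by case: (set_mem (valP y)) => [sy ys] Sx'; split; [exact: (reachable_reads Sx' sy) | exact: (reachable_reads Sx' ys)].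
pose f (y : strong_component (cayley G) s) := shift (inv_repr (val y)).
have f_inj : injective f.
  move=> y y' ff; apply/val_inj; rewrite -[LHS]inv_reprK -[RHS]inv_reprK.
  apply/inv_classP/inv_cong_read_kernel; split=> // x' Sx' j.
  by rewrite !same.
have fin := finite_int_interval (- N - i) (N + 1 - i).
apply: sub_finite_set (finite_preimage (f := f) _ fin) => [y _ /=|y y' _ _ /f_inj] //.
have : - N <= i + f y <= N + 1 by apply: reads_window xN iN _; rewrite same.
by lia.
Qed.

End Component.

(** * The monoid *)

(** The labels [true] and [false] are the letters a and b. *)
Definition doubled (n : nat) : set (line bool) :=
  [set x | forall i j : int, i < j <= i + n%:Z ->
    x true i -> x true j -> x false j].

Definition always_doubled : set (line bool) := \bigcap_n doubled n.

Definition doubling_monoid : inverseMonoidType := Inv (read_kernel always_doubled).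

(** A word starting at i only sees the edges at distance at most its length
    from i. Cutting a line of [doubled n] down to these edges keeps the
    doubling condition, since the b-edge that it demands sits on the same edge
    as an a-edge that was kept; and when n exceeds the length of the interval,
    the distances over n no longer occur. *)
Lemma always_doubled_limit u v : read_kernel always_doubled (u, v) ->
  eventually (fun n => inv_cong (read_kernel (doubled n)) u v).
Proof.
move=> [/= uv H]; pose N := (size u + size v)%N.
exists (N + N)%N => n nN; apply/inv_cong_read_kernel; split=> //= x xn i.
pose y : line bool := fun a j => (i - N%:Z <= j <= i + N%:Z) /\ x a j.
have xy w : (size w <= N)%N -> reads x i w <-> reads y i w.
  by move=> wN; apply: reads_local => a j jw; split=> [xj|[]//]; split=> //; lia.
rewrite !xy ?leq_addl ?leq_addr //; apply: H => m _ p q pq [pN xp] [qN xq].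
by split=> //; apply: (xn p q) => //; lia.
Qed.

(** The separating relation is [a b^n a = a b^n a b^-1 b]: the right-hand side
    requires in addition that the last a-edge is doubled. It fails on the line
    with a-edges at 0 and n + 1 only, joined by b-edges. *)
Lemma doubled_kernel_strict n :
  exists u v, read_kernel always_doubled (u, v) /\
    ~ inv_cong (read_kernel (doubled n)) u v.
Proof.
pose u : word bool := inl true :: nseq n (inl false) ++ [:: inl true].
pose c : word bool := [:: inr false; inl false].
have shift_run m : shift (nseq m (inl false : bool + bool)) = m%:Z.
  elim: m => [|m IHm]; first by rewrite /shift big_nil.
  by rewrite [nseq _ _]/= shift_cons IHm /=; lia.
have shu : shift u = n%:Z + 2.
  by rewrite shift_cons shift_cat shift_run /shift big_seq1 /=; lia.
exists u, (u ++ c); split.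
  split=> [|x xS i].
    rewrite -[LHS]/(shift u) -[RHS]/(shift (u ++ c)) shift_cat.
    have -> : shift c = 0 by rewrite /shift !big_cons big_nil.
    by rewrite addr0.
  change (reads x i u <-> reads x i (u ++ c)).
  rewrite reads_cat; split=> [xu|[]//]; split=> //; rewrite shu.
  case: xu => /= xi /reads_cat [_ /= [xj _]]; move: xj; rewrite shift_run => xj.
  have xb : x false (i + 1 + n%:Z) by apply: (xS n.+1 I i) => //; lia.
  have e1 : i + (n%:Z + 2) - 1 = i + 1 + n%:Z by lia.
  by rewrite /= e1.
move=> /inv_cong_read_kernel [_ H].
pose x : line bool := fun a j => if a then j = 0 \/ j = n.+1 else 1 <= j <= n%:Z.
have reads_run i m : 1 <= i -> i + m%:Z <= n%:Z + 1 ->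
    reads x i (nseq m (inl false)).
  by elim: m i => [|m IHm] i //= i1 im; split; [lia | apply: IHm; lia].
have xS : doubled n x by move=> i j ij /=; lia.
have xu : reads x 0 u.
  split; first by left.
  rewrite [letter_shift _]/= reads_cat shift_run; split.
    by apply: reads_run; lia.
  by split=> //; right => /=; lia.
have /reads_cat [_ [+ _]] : reads x 0 (u ++ c) by apply/(H x xS).
by rewrite shu /=; lia.
Qed.

Lemma doubling_monoid_tree_like (R : realType) : tree_like R doubling_monoid.
Proof.
exists [set inv_class (read_kernel always_doubled) [:: inl a] | a in [set: bool]].
split.
- exact: finite_image.
- apply/seteqP; split=> // y _ K [[K1 KM KV] GK].
  rewrite -(inv_reprK y); elim: (inv_repr y) => [|l u IHu]; first exact: K1.
  rewrite -cat1s inv_classM; apply: KM IHu; case: l => a; first by apply: GK; exists a.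
  rewrite -[[:: inr a]]/(word_inv [:: inl a]) inv_class_inv.
  by apply: KV; apply: GK; exists a.
- move=> s; set G := (X in schutzenberger X).
  have s0 : strong_component (cayley G) s s by split; exists 0%N, [::].
  apply: finite_quasi_isometric_to_tree (SigSub (mem_set s0)) _.
  (* the word representing s can be read from the middle of this interval *)
  pose N := size (inv_repr s).
  pose x : line bool := fun _ j => - N%:Z <= j <= N%:Z.
  apply: (@finite_strong_component _ _ G s N%:Z x 0) => //.
  + by move=> n _ i j _ _ /=.
  + lia.
  + apply/(@reads_local _ _ (fun _ _ => True)) => [a j|]; first by rewrite /x /N; split=> // _; lia.
    by elim: (inv_repr s) (0 : int) => //= l u IHu i; split=> //; case: l.
Qed.

Theorem corollary4p7 (R : realType) :
  exists M : inverseMonoidType, tree_like R M /\ ~ finitely_presentable M.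
Proof.
exists doubling_monoid; split; first exact: doubling_monoid_tree_like.
move=> /(finitely_presentable_limit always_doubled_limit) [n].
by have [u [v [uv nuv]]] := doubled_kernel_strict n => /(_ u v uv).
Qed.
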